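(* Let $\psi$ be a non-constant analytic function on $\mathbb{D}$ and let $\phi(z)=tz$ with $-1\le t\le0$, such that $C_{\psi,\phi}$ is a bounded operator on $\mathcal{D}$. Then $0$ lies in the numerical range $W(C_{\psi,\phi})$.
   Context: $\mathbb{D}=\{z\in\mathbb{C}:|z|<1\}$. The Dirichlet space $\mathcal{D}$ is the Hilbert space of all holomorphic $f(z)=\sum_{n\ge0}\hat f_nz^n$ on $\mathbb{D}$ with $\sum_{n\ge 0}(n+1)|\hat f_n|^2<\infty$ (equivalently $\int_{\mathbb{D}}|f'|^2dA<\infty$), with inner product $\langle f,g\rangle_{\mathcal{D}}=\sum_{n\ge0}(n+1)\hat f_n\overline{\hat g_n}$. The weighted composition operator is $(C_{\psi,\phi}f)(z)=\psi(z)f(\phi(z))$. The numerical range of a bounded operator $T$ on a Hilbert space $\mathcal{H}$ is $W(T)=\{\langle Tf,f\rangle:f\in\mathcal{H},\|f\|=1\}$. *)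

(* Defs.v *)
From HB Require Import structures.
From mathcomp Require Import all_boot all_order all_algebra.
From mathcomp Require Import all_classical all_reals all_analysis.
From mathcomp Require Import complex.

Set Implicit Arguments.
Unset Strict Implicit.
Unset Printing Implicit Defensive.

Import Order.TTheory GRing.Theory Num.Theory.
Import numFieldNormedType.Exports.

Local Open Scope classical_set_scope.
Local Open Scope ring_scope.

(* The field of complex numbers with its numFieldType structure made explicit,
   so that its norm topology (values of type [Cplx R]^o) is inferred. *)
Definition Cplx (R : realType) : numClosedFieldType := R[i].

Section DirichletSpace.
Variable R : realType.
Local Notation C := (Cplx R).
Implicit Types (f g psi phi : C -> C) (T : (C -> C) -> (C -> C)).

Definition disk : set C := [set z | `|z| < 1].

(* A function on the disk is encoded as a total function on the plane whose
   values outside the disk are junk: holomorphy, Taylor coefficients, and hence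
   the inner product, only see its restriction to the disk.  Directional
   derivability in direction 1 is over the scalar field of complex numbers, so
   it is complex differentiability. *)
Definition holomorphic_on_disk f : Prop :=
  forall z : C, disk z -> derivable (f : C -> C^o) z 1.

Definition taylor_coef f (n : nat) : C :=
  derive1n n (f : C -> C^o) 0 / (n`!)%:R.

Definition dirichlet : set (C -> C) := [set f |
  [/\ holomorphic_on_disk f,
      forall z : C, disk z ->
        series (fun n => taylor_coef f n * z ^+ n : C^o) @ \oo --> (f z : C^o)
    & cvgn (series (fun n => n.+1%:R * `|taylor_coef f n| ^+ 2 : C^o))]].

Definition dirichlet_ip f g : C :=
  limn (series (fun n =>
    n.+1%:R * (taylor_coef f n * (taylor_coef g n)^* ) : C^o)).

Definition dirichlet_norm f : R := Num.sqrt (complex.Re (dirichlet_ip f f)).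

Definition wcomp psi phi : (C -> C) -> (C -> C) :=
  fun f z => psi z * f (phi z).

(* Linearity is not part of this predicate: it is automatic for [wcomp]. *)
Definition bounded_on_dirichlet T : Prop :=
  (forall f, dirichlet f -> dirichlet (T f)) /\
  exists M : R, forall f, dirichlet f ->
    dirichlet_norm (T f) <= M * dirichlet_norm f.

Definition numerical_range T : set C :=
  [set w | exists f, [/\ dirichlet f, dirichlet_norm f = 1
                       & w = dirichlet_ip (T f) f]].

End DirichletSpace.

(* Main.v *)
Require Import Defs.
From mathcomp Require Import all_boot all_order all_algebra.
From mathcomp Require Import all_classical all_reals all_analysis.
From mathcomp Require Import complex ring.
(** Why [0] is attained.  The compression of the operator to the span of [1]
    and [z] is lower triangular, because multiplication by [psi] and
    substitution of [t * z] never lower the order of vanishing at [0].  With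
    [a = psi 0], its diagonal entries are the eigenvalues [a] and [t * a],
    which lie on opposite sides of [0] on a real line, since [t <= 0].  By the
    convexity of numerical ranges, [0] belongs to the numerical range of this
    two-dimensional compression, hence to that of the operator.

    Convexity is replaced by an explicit vector.  With [b] the first Taylor
    coefficient of [psi], the unknown function [p + q * z] must satisfy
    [a * (|p|^2 + 2 * t * |q|^2) + 2 * b * p * q^* = 0].  Put [q = 1].  If
    [a = 0], then [p = 0] solves it.  Otherwise, choosing the argument of [p]
    so that [(b / a) * p] is real turns it into a real quadratic equation with
    discriminant proportional to [|b / a|^2 - 2 * t >= 0]
    ([norm_quadratic_root]); rescaling gives a unit vector
    ([isotropic_unit_vector]).  The inner product against an affine function
    involves two Taylor coefficients only ([dirichlet_ip_affine]), and those of
    the image of [p + q * z] come from the Leibniz rule. *)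

Set Implicit Arguments.
Unset Strict Implicit.
Unset Printing Implicit Defensive.
Import Order.TTheory GRing.Theory Num.Theory.
Import numFieldNormedType.Exports.
Local Open Scope classical_set_scope.
Local Open Scope ring_scope.

(** Writing [p = u * s] with [s] real and [u] of modulus 1 rotating [b] onto
    [`|b|], the equation becomes [s ^+ 2 + 2 * `|b| * s + 2 * t = 0], whose
    roots are real since the product [2 * t] of the roots is nonpositive. *)
Lemma norm_quadratic_root (C : numClosedFieldType) (b t : C) : t <= 0 ->
  exists p : C, `|p| ^+ 2 + 2 * b * p + 2 * t = 0.
Proof.
move=> t0.
have [u u1 bu] : exists2 u : C, `|u| = 1 & b * u = `|b|.
  have [->|b0] := eqVneq b 0; first by exists 1; rewrite ?normr1 ?mul0r ?normr0.
  exists (`|b| / b); last by rewrite mulrC divfK.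
  by rewrite normf_div normr_id divff ?normr_eq0.
have disc0 : 0 <= `|b| ^+ 2 - 2 * t.
  by rewrite addr_ge0 ?exprn_ge0// oppr_ge0 mulr_ge0_le0.
pose s := sqrtC (`|b| ^+ 2 - 2 * t) - `|b|.
have s_real : s \is Num.real.
  by rewrite rpredB ?normr_real// ger0_real ?sqrtC_ge0.
exists (u * s).
rewrite normrM u1 mul1r real_normK// mulrA -(mulrA 2) bu.
have : (s + `|b|) ^+ 2 = `|b| ^+ 2 - 2 * t by rewrite subrK sqrtCK.
move=> e; transitivity ((s + `|b|) ^+ 2 - `|b| ^+ 2 + 2 * t); first by ring.
by rewrite e; ring.
Qed.

(** The vanishing form is the quadratic form of the matrix with columns
    [(a, b)] and [(0, t * a)], for the inner product in which the second basis
    vector has squared norm 2, the Dirichlet weight of [z]. *)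
Lemma isotropic_unit_vector (C : numClosedFieldType) (a b t : C) : t <= 0 ->
  exists p q : C, `|p| ^+ 2 + 2 * `|q| ^+ 2 = 1 /\
    a * p * p^* + 2 * (a * (t * q) + b * p) * q^* = 0.
Proof.
move=> t0.
have [p hp] : exists p : C, a * (p * p^* + 2 * t) + 2 * b * p = 0.
  have [->|a0] := eqVneq a 0; first by exists 0; rewrite mul0r mulr0 addr0.
  have [p hp] := norm_quadratic_root (b / a) t0.
  exists p; move: hp; rewrite normCK => /(congr1 ( *%R a)); rewrite mulr0 => <-.
  by field.
(* The equation is homogeneous in (p, q), so (p, 1) can be normalised. *)
have N0 : 0 < `|p| ^+ 2 + 2 by rewrite ltr_wpDl ?exprn_ge0.
pose l := (sqrtC (`|p| ^+ 2 + 2))^-1.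
have l0 : 0 <= l by rewrite invr_ge0 sqrtC_ge0 ltW.
exists (l * p), l; split.
  rewrite normrM ger0_norm// exprMn mulrC (mulrC 2).
  rewrite (mulrC _ (l ^+ 2)) -mulrDr exprVn sqrtCK mulVf// gt_eqF//.
rewrite rmorphM/= geC0_conj//.
transitivity (l ^+ 2 * (a * (p * p^* + 2 * t) + 2 * b * p)); first by ring.
by rewrite hp mulr0.
Qed.

Section Affine.
Variable R : realType.
Local Notation C := (Cplx R).
Implicit Types (f g : C -> C) (p q z : C).

Lemma taylor_coef0 f : taylor_coef f 0 = f 0.
Proof. by rewrite /taylor_coef derive1n0 fact0 divr1. Qed.

Lemma taylor_coef1 f d : is_derive (0 : C^o) (1 : C^o) (f : C^o -> C^o) d ->
  taylor_coef f 1 = d.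
Proof.
by move=> fd; rewrite /taylor_coef derive1n1 derive1E derive_val divr1.
Qed.

Definition affine p q : C -> C := fun z => p + q * z.

Lemma is_derive_affine p q (z : C^o) :
  is_derive z (1 : C^o) (affine p q : C^o -> C^o) q.
Proof.
have -> : (affine p q : C^o -> C^o) = (cst p : C^o -> C^o) + (q *: (id : C^o -> C^o)).
  by [].
have qid := is_deriveZ q (is_derive_id (z : C^o) (1 : C^o)).
apply: (is_derive_eq (is_deriveD (is_derive_cst (p : C^o) z 1) qid)).
by rewrite add0r; exact: mulr1.
Qed.

Lemma taylor_coef_affine p q n :
  taylor_coef (affine p q) n = [:: p; q]`_n.
Proof.
case: n => [|[|n]]; first by rewrite taylor_coef0 /affine mulr0 addr0.
  by rewrite (taylor_coef1 (is_derive_affine p q 0)).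
rewrite /taylor_coef derive1Sn derive1Sn.
have -> : derive1 (affine p q : C^o -> C^o) = cst (q : C^o).
  apply/funext => z; rewrite derive1E.
  exact: (@derive_val _ _ _ _ _ _ _ (is_derive_affine p q z)).
have d0 (c : C^o) : derive1 (cst c : C^o -> C^o) = cst 0.
  by apply/funext => z; rewrite derive1_cst.
rewrite d0 /= nth_nil.
have -> : derive1n n (cst 0 : C^o -> C^o) = cst 0.
  by elim: n => // n IH; rewrite derive1nS IH d0.
by rewrite mul0r.
Qed.

(** All the series attached to an affine function have at most two nonzero
    terms, so that their convergence and their sums come from here. *)
Lemma cvg_series2 (u : nat -> C^o) : (forall n, u n.+2 = 0) ->
  series u @ \oo --> u 0%N + u 1%N.
Proof.
move=> u0; apply: cvg_near_cst; exists 2%N => // -[|[|n]]//= _.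
rewrite /series/= big_nat_recl// big_nat_recl//= big1 ?addr0//.
Qed.

Lemma dirichlet_affine p q : dirichlet (affine p q).
Proof.
split=> [z _|z _|].
- exact: (@ex_derive _ _ _ _ _ _ _ (is_derive_affine p q z)).
- have := @cvg_series2 (fun n => taylor_coef (affine p q) n * z ^+ n).
  rewrite !taylor_coef_affine expr0 mulr1 expr1; apply=> n.
  by rewrite taylor_coef_affine /= nth_nil mul0r.
- apply/cvg_ex; eexists; apply: cvg_series2 => n.
  by rewrite taylor_coef_affine /= nth_nil normr0 expr0n mulr0.
Qed.

Lemma dirichlet_ip_affine g p q :
  dirichlet_ip g (affine p q) =
    taylor_coef g 0 * p^* + 2 * taylor_coef g 1 * q^*.
Proof.
rewrite /dirichlet_ip; apply: cvg_lim => //.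
have := @cvg_series2 (fun n =>
  n.+1%:R * (taylor_coef g n * (taylor_coef (affine p q) n)^*)).
rewrite !taylor_coef_affine mul1r mulrA; apply=> n.
by rewrite taylor_coef_affine /= nth_nil rmorph0 !mulr0.
Qed.

Lemma dirichlet_norm_affine p q : `|p| ^+ 2 + 2 * `|q| ^+ 2 = 1 ->
  dirichlet_norm (affine p q) = 1.
Proof.
move=> pq1; rewrite /dirichlet_norm dirichlet_ip_affine !taylor_coef_affine /=.
by rewrite -mulrA -!normCK pq1 sqrtr1.
Qed.

End Affine.

Theorem theorem3p9 (R : realType) (psi : Cplx R -> Cplx R) (t : R)
  (psi_holo : holomorphic_on_disk psi)
  (psi_nonconst : ~ exists c : Cplx R, forall z : Cplx R, disk z -> psi z = c)
  (t_ge : -1 <= t) (t_le : t <= 0)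
  (bdd : bounded_on_dirichlet (wcomp psi (fun z : Cplx R => t%:C%C * z))) :
  numerical_range (wcomp psi (fun z : Cplx R => t%:C%C * z)) 0.
Proof.
have tC : (t%:C%C : Cplx R) <= 0 by rewrite lecR.
have [p [q [pq1 pq0]]] :=
  isotropic_unit_vector (psi 0) (taylor_coef psi 1) tC.
exists (affine p q); split; first exact: dirichlet_affine.
  exact: dirichlet_norm_affine.
have psi1 : is_derive (0 : (Cplx R)^o) (1 : (Cplx R)^o)
    (psi : (Cplx R)^o -> (Cplx R)^o) (taylor_coef psi 1).
  have dpsi : derivable (psi : Cplx R -> (Cplx R)^o) 0 1.
    by apply: psi_holo; rewrite /disk/= normr0.
  rewrite /taylor_coef derive1n1 derive1E divr1.
  exact/derivableP.
(* The factor t is moved onto q, so that the Leibniz rule applies to a product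
   of psi with an affine function. *)
have -> : wcomp psi (fun z : Cplx R => t%:C%C * z) (affine p q) =
    (psi : (Cplx R)^o -> (Cplx R)^o) * (affine p (t%:C%C * q) : (Cplx R)^o -> (Cplx R)^o).
  by apply/funext => z; rewrite /wcomp/affine /= mulrCA mulrA.
rewrite dirichlet_ip_affine taylor_coef0.
rewrite (taylor_coef1 (is_deriveM psi1 (is_derive_affine p (t%:C%C * q) 0))).
rewrite -[RHS]/(psi 0 * (p + t%:C%C * q * 0) * p^* +
  2 * (psi 0 * (t%:C%C * q) + (p + t%:C%C * q * 0) * taylor_coef psi 1) * q^*).
by rewrite mulr0 addr0 (mulrC p) pq0.
Qed.
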